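(* For each non-negative integer $n$, \[ \sum_{k=0}^n (-1)^{k} \binom {n+k}{k} \frac{F_{2(n+1)-k}}{2^k} = 2^n - \sum_{k=0}^{n-1} (-1)^{k}\binom {2k+1}{k} 2^{n-2k-1} F_{k+2}, \] \[ \sum_{k=0}^n (-1)^{k}\binom {n+k}{k} \frac{L_{2(n+1)-k}}{2^k} = 3\cdot 2^n - \sum_{k=0}^{n-1} (-1)^{k}\binom {2k+1}{k} 2^{n-2k-1} L_{k+2}. \]
   Context: $F_j$ and $L_j$ denote the Fibonacci and Lucas numbers: $F_0=0,F_1=1$, $L_0=2,L_1=1$, both satisfying $X_j=X_{j-1}+X_{j-2}$. *)

(* Defs.v *)
From mathcomp Require Import all_boot.

Fixpoint fib (n : nat) : nat :=
  match n with
  | 0 => 0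
  | p.+1 => match p with 0 => 1 | q.+1 => fib p + fib q end
  end.

Fixpoint lucas (n : nat) : nat :=
  match n with
  | 0 => 2
  | p.+1 => match p with 0 => 1 | q.+1 => lucas p + lucas q end
  end.

(* Main.v *)
Require Import Defs.
From mathcomp Require Import all_boot all_order all_algebra.
From mathcomp Require Import ring zify.
Import GRing.Theory.
Local Open Scope ring_scope.

(** Let [S n] be the left-hand side for a sequence [G] with
    [G (i + 2) = G (i + 1) + G i].  It suffices that
    [S (n + 1) = 2 S n - (-1)^n C(2n+1, n) 2^(-n) G (n + 2)], since the
    right-hand side satisfies the same recurrence.  For [G i = x^i] with
    [x^2 = x + 1] and [y = -1/(2x)] one has [1 - y = x^2 / 2], so
    [S (n + 1) - 2 S n] is, up to a factor, the difference between
    [(1 - y) \sum_k C(n+1+k, k) y^k] and [\sum_k C(n+k, k) y^k], which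
    telescopes by Pascal's rule. *)

Lemma gibonacci_telescope (R : numFieldType) (G : nat -> R)
    (G_rec : forall i, G i.+2 = G i.+1 + G i) (n N m : nat) : (m <= N)%N ->
  \sum_(0 <= k < m) (-1) ^+ k * 'C(n.+1 + k, k)%:R * (G (N.+2 - k)%N / 2 ^+ k)
  - 2 * \sum_(0 <= k < m) (-1) ^+ k * 'C(n + k, k)%:R * (G (N - k)%N / 2 ^+ k)
  = - 2 * ((-1) ^+ m * 'C(n + m, n.+1)%:R * (G (N - m)%N / 2 ^+ m)).
Proof.
elim: m => [_|m IHm ltmN].
  by rewrite !big_geq // addn0 bin_small // !(mulr0, mul0r) subr0.
rewrite !big_nat_recr //= mulrDr opprD addrACA IHm ?(ltnW ltmN) //.
have -> : 'C(n.+1 + m, m) = ('C(n + m, n.+1) + 'C(n + m, n))%N.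
  by rewrite -bin_sub ?leq_addl // addnK addSn binS.
have -> : 'C(n + m, m) = 'C(n + m, n) by rewrite -bin_sub ?leq_addl // addnK.
rewrite addnS binS.
(* With [N = m + d + 1] no index is truncated, and [G_rec] reduces every term to [G d] and
   [G d.+1]. *)
have [d ->] : exists d, N = (m + d).+1 by exists (N - m.+1)%N; lia.
have -> : ((m + d).+3 - m = d.+3)%N by lia.
have -> : ((m + d).+1 - m = d.+1)%N by lia.
have -> : ((m + d).+1 - m.+1 = d)%N by lia.
rewrite !G_rec !natrD !exprS.
by field; rewrite expf_neq0 // Num.Theory.pnatr_eq0.
Qed.

Lemma gibonacci_sum (R : numFieldType) (G : nat -> R)
    (G_rec : forall i, G i.+2 = G i.+1 + G i) (n : nat) :
  \sum_(0 <= k < n.+1)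
     (-1) ^+ k * 'C(n + k, k)%:R * (G (2 * (n + 1) - k)%N / 2 ^+ k)
  = G 2 * 2 ^+ n
    - \sum_(0 <= k < n)
        (-1) ^+ k * 'C(2 * k + 1, k)%:R
          * 2 ^ (n%:Z - 2 * k%:Z - 1) * G (k + 2)%N.
Proof.
have two_neq0 : 2 != 0 :> R by rewrite Num.Theory.pnatr_eq0.
elim: n => [|n IHn].
  by rewrite big_nat1 big_geq // !expr0 bin0 divr1 !mul1r mulr1 subr0.
(* This choice covers the whole sum for [n] and all but the last term of the sum for [n.+1]. *)
have step := gibonacci_telescope _ _ G_rec n (2 * (n + 1)) n.+1 ltac:(lia).
rewrite IHn in step.
rewrite big_nat_recr //= [X in _ - X]big_nat_recr //=.
have -> : (2 * (n.+1 + 1) = (2 * (n + 1)).+2)%N by lia.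
rewrite -[X in X + _ = _](subrK (2 * (G 2 * 2 ^+ n
    - \sum_(0 <= k < n) (-1) ^+ k * 'C(2 * k + 1, k)%:R
          * 2 ^ (n%:Z - 2 * k%:Z - 1) * G (k + 2)%N))) step.
have -> : \sum_(0 <= k < n) (-1) ^+ k * 'C(2 * k + 1, k)%:R
          * 2 ^ (n.+1%:Z - 2 * k%:Z - 1) * G (k + 2)%N
   = 2 * \sum_(0 <= k < n) (-1) ^+ k * 'C(2 * k + 1, k)%:R
          * 2 ^ (n%:Z - 2 * k%:Z - 1) * G (k + 2)%N.
  rewrite mulr_sumr; apply: eq_bigr => k _.
  have -> : n.+1%:Z - 2 * k%:Z - 1 = 1 + (n%:Z - 2 * k%:Z - 1) by lia.
  by rewrite expfzDr // expr1z; ring.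
have -> : n.+1%:Z - 2 * n%:Z - 1 = - n%:Z by lia.
(* By this symmetry the boundary term and the last term combine through
   [G n.+3 - G n.+1 = G n.+2]. *)
have Cmid : 'C(2 * n + 1, n.+1) = 'C(2 * n + 1, n).
  by rewrite -bin_sub; [congr ('C(_, _))|]; lia.
have -> : (n + n.+1 = 2 * n + 1)%N by lia.
have -> : (n.+1 + n.+1 = (2 * n + 1).+1)%N by lia.
rewrite binS Cmid.
have -> : ((2 * (n + 1)).+2 - n.+1 = n.+3)%N by lia.
have -> : (2 * (n + 1) - n.+1 = n.+1)%N by lia.
rewrite addn2 !G_rec natrD !exprS -exprnN.
by field; rewrite expf_neq0.
Qed.

(* The index 2 * (n + 1) - k is never truncated, since k <= n; the exponent
   n - 2k - 1 is an integer and may be negative. *)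
Theorem theorem16 (n : nat) :
  \sum_(0 <= k < n.+1)
     (-1) ^+ k * 'C(n + k, k)%:R * ((fib (2 * (n + 1) - k))%:R / 2 ^+ k)
  = 2 ^+ n
    - \sum_(0 <= k < n)
        (-1) ^+ k * 'C(2 * k + 1, k)%:R
          * 2 ^ (n%:Z - 2 * k%:Z - 1) * (fib (k + 2))%:R
  :> rat
  /\
  \sum_(0 <= k < n.+1)
     (-1) ^+ k * 'C(n + k, k)%:R * ((lucas (2 * (n + 1) - k))%:R / 2 ^+ k)
  = 3 * 2 ^+ n
    - \sum_(0 <= k < n)
        (-1) ^+ k * 'C(2 * k + 1, k)%:R
          * 2 ^ (n%:Z - 2 * k%:Z - 1) * (lucas (k + 2))%:R
  :> rat.
Proof.
split.
(* The leading coefficients are [fib 2 = 1] and [lucas 2 = 3]. *)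
- rewrite (@gibonacci_sum _ (fun i => (fib i)%:R)) ?mul1r // => i.
  by rewrite -natrD.
- rewrite (@gibonacci_sum _ (fun i => (lucas i)%:R)) // => i.
  by rewrite -natrD.
Qed.
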